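(* Let $\Gamma$ be a simple digraph of order $n\ge 2$. Then $\operatorname{sp}(\Gamma)=0$ if and only if $\Gamma$ is a $k$-imploding star (for some $k\in\{0,1,\dots,n\}$) or a regular tournament.
   Context: A simple digraph $\Gamma=(V,E)$ of order $n$ has vertex set $V=\{1,\dots,n\}$ and edge set $E\subseteq V\times V$ with no loops and no multi-edges (both $(i,j)$ and $(j,i)$ may be edges). Its adjacency matrix is $A=[a_{ij}]$ with $a_{ij}=1$ if $(i,j)\in E$ and $a_{ij}=0$ otherwise, and its Laplacian matrix is $L=D-A$, where $D$ is the diagonal matrix whose $i$th diagonal entry is the out-degree $d^+(i)$ (the number of edges of the form $(i,j)\in E$). Let $\mathbf{e}$ be the all ones vector in $\mathbb{R}^n$. For $n\ge 2$ define \[ \alpha(\Gamma)=\min_{\mathbf{x}\in\mathbb{R}^n,\ \mathbf{x}\perp\mathbf{e},\ \|\mathbf{x}\|=1}\mathbf{x}^TL\mathbf{x},\qquad \beta(\Gamma)=\max_{\mathbf{x}\in\mathbb{R}^n,\ \mathbf{x}\perp\mathbf{e},\ \|\mathbf{x}\|=1}\mathbf{x}^TL\mathbf{x}, \] where $\|\cdot\|$ is the Euclidean norm. The Laplacian spread is $\operatorname{sp}(\Gamma)=\beta(\Gamma)-\alpha(\Gamma)$. $K_m$ denotes the complete digraph of order $m$ (all ordered pairs of distinct vertices are edges) and $\overline{K_m}$ the empty digraph of order $m$ (no edges); $K_0=\overline{K_0}$ is the null digraph. The directed join of digraphs $\Gamma_1=(V_1,E_1)$ and $\Gamma_2=(V_2,E_2)$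 with $V_1\cap V_2=\emptyset$ is the digraph with vertex set $V_1\sqcup V_2$ and edge set $E_1\sqcup E_2\sqcup\{(i,j): i\in V_1,\ j\in V_2\}$. For $k\in\{0,1,\dots,n\}$, the $k$-imploding star of order $n$ is the directed join of $\overline{K_{n-k}}$ (first) and $K_k$ (second). A regular tournament of order $n$, where $n\ge3$ is odd, is a tournament digraph (for each pair of distinct vertices $i,j$ exactly one of $(i,j),(j,i)$ is an edge) in which each vertex has in-degree and out-degree equal to $(n-1)/2$. Digraphs are considered up to isomorphism. *)

(* Defs.v *)
From HB Require Import structures.
From mathcomp Require Import all_boot all_order all_algebra.
From mathcomp Require Import all_classical all_reals all_analysis.

Set Implicit Arguments.
Unset Strict Implicit.
Unset Printing Implicit Defensive.

Import Order.TTheory GRing.Theory Num.Theory.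
Import numFieldNormedType.Exports.
Local Open Scope classical_set_scope.
Local Open Scope ring_scope.

Record digraph (V : finType) := Digraph {
  edge : rel V;
  edge_irrefl : irreflexive edge }.

Definition outdeg (V : finType) (G : digraph V) (i : V) : nat :=
  #|[pred j | edge G i j]|.

Definition indeg (V : finType) (G : digraph V) (i : V) : nat :=
  #|[pred j | edge G j i]|.

Definition iso (V W : finType) (G : digraph V) (H : digraph W) : Prop :=
  exists2 f : V -> W, bijective f & forall i j, edge H (f i) (f j) = edge G i j.

Definition complete_digraph (V : finType) : digraph V :=
  @Digraph V (fun i j => i != j) (fun i => negbF (eqxx i)).

Definition empty_digraph (V : finType) : digraph V :=
  @Digraph V (fun _ _ => false) (fun=> erefl).

Section DirectedJoin.
Variables (V1 V2 : finType) (G1 : digraph V1) (G2 : digraph V2).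

Definition djoin_edge (u v : V1 + V2) : bool :=
  match u, v with
  | inl i, inl j => edge G1 i j
  | inr i, inr j => edge G2 i j
  | inl _, inr _ => true
  | inr _, inl _ => false
  end.

Lemma djoin_irrefl : irreflexive djoin_edge.
Proof. by case=> i /=; rewrite edge_irrefl. Qed.

Definition djoin : digraph (V1 + V2)%type := Digraph djoin_irrefl.

End DirectedJoin.

(* Truncated subtraction: this has order n only when k <= n. *)
Definition imploding_star (n k : nat) : digraph ('I_(n - k) + 'I_k)%type :=
  djoin (empty_digraph 'I_(n - k)) (complete_digraph 'I_k).

Definition tournament (V : finType) (G : digraph V) : Prop :=
  forall i j, i != j -> edge G i j (+) edge G j i.

Definition regular_tournament (V : finType) (G : digraph V) : Prop :=
  [/\ (3 <= #|V|)%N, odd #|V|, tournament G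
    & forall i, indeg G i = (#|V|.-1)./2 /\ outdeg G i = (#|V|.-1)./2].

Section Laplacian.
Variables (R : realType) (n : nat).
Implicit Types (G : digraph 'I_n) (x y : 'cV[R]_n).

Definition adjacency G : 'M[R]_n := \matrix_(i, j) (edge G i j)%:R.

Definition laplacian G : 'M[R]_n :=
  diag_mx (\row_i (outdeg G i)%:R) - adjacency G.

Definition dot x y : R := (x^T *m y) 0 0.

(* The library norm `|x| on matrices is the sup norm, not this one. *)
Definition enorm x : R := Num.sqrt (dot x x).

Definition quadform (M : 'M[R]_n) x : R := (x^T *m M *m x) 0 0.

Definition unit_perp_ones : set 'cV[R]_n :=
  [set x | dot x (const_mx 1) = 0 /\ enorm x = 1].

(* For n >= 2 these are the minimum and the maximum: alphaP and betaP. *)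
Definition alpha G : R := inf [set quadform (laplacian G) x | x in unit_perp_ones].

Definition beta G : R := sup [set quadform (laplacian G) x | x in unit_perp_ones].

Definition lspread G : R := beta G - alpha G.

End Laplacian.

Section Attained.
Variables (R : realType) (n : nat).
Hypothesis n_ge2 : (2 <= n)%N.
Local Notation S := (@unit_perp_ones R n).

Lemma dotE (x y : 'cV[R]_n) : dot x y = \sum_i x i 0 * y i 0.
Proof. by rewrite /dot mxE; apply: eq_bigr => i _; rewrite mxE. Qed.

Lemma quadformE (M : 'M[R]_n) x :
  quadform M x = \sum_j (\sum_i x i 0 * M i j) * x j 0.
Proof.
rewrite /quadform mxE; apply: eq_bigr => j _; rewrite mxE; congr (_ * _).
by apply: eq_bigr => i _; rewrite mxE.
Qed.

Lemma unit_perp_onesE :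
  [set y : 'rV[R]_n | S y^T] =
  [set y | \sum_i y 0 i = 0] `&` [set y | \sum_i y 0 i * y 0 i = 1].
Proof.
apply/seteqP; split=> y /=; rewrite /unit_perp_ones /= /enorm !dotE.
  move=> [h1 h2]; split.
    by rewrite -[RHS]h1; apply: eq_bigr => i _; rewrite !mxE mulr1.
  have h : 0 <= \sum_i y 0 i * y 0 i by apply: sumr_ge0 => i _; rewrite -expr2 sqr_ge0.
  rewrite -(sqr_sqrtr h) -[RHS](expr1n _ 2) -h2; congr (Num.sqrt _ ^+ 2).
  by apply: eq_bigr => i _; rewrite !mxE.
move=> [h1 h2]; split.
  by rewrite -[RHS]h1; apply: eq_bigr => i _; rewrite !mxE mulr1.
rewrite -[RHS]sqrtr1 -h2; congr Num.sqrt.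
by apply: eq_bigr => i _; rewrite !mxE.
Qed.

Lemma continuous_sum_rV (I : finType) (f : I -> 'rV[R]_n -> R) :
  (forall i, continuous (f i)) -> continuous (fun y => \sum_i f i y).
Proof.
by move=> cf; apply: continuous_big => //; exact: add_continuous.
Qed.

Lemma continuous_mul_rV (f g : 'rV[R]_n -> R) :
  continuous f -> continuous g -> continuous (fun y => f y * g y).
Proof. by move=> cf cg y; apply: continuousM; [exact: cf | exact: cg]. Qed.

Lemma unit_perp_ones_compact : compact [set y : 'rV[R]_n | S y^T].
Proof.
rewrite unit_perp_onesE; apply: bounded_closed_compact.
  exists 1; split => // M M1 y /= [_ h]; apply: (le_trans _ (ltW M1)).
  rewrite [leLHS]/(`| _ |) /= mx_normrE.
  apply/bigmax_leP; split => // -[i j] _ /=; rewrite ord1.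
  rewrite -(expr_le1 (n := 2)) // real_normK ?num_real // -h.
  rewrite (bigD1 j) //= expr2 lerDl; apply: sumr_ge0 => k _.
  by rewrite -expr2 sqr_ge0.
apply: closedI.
  apply: (@preimage_closed _ _ (fun y : 'rV[R]_n => \sum_i y 0 i) [set 0]).
    by move=> y _; apply: continuous_sum_rV => i {}y; apply: coord_continuous.
  exact: closed_eq.
apply: (@preimage_closed _ _ (fun y : 'rV[R]_n => \sum_i y 0 i * y 0 i) [set 1]).
  move=> y _; apply: continuous_sum_rV => i.
  by apply: continuous_mul_rV; exact: coord_continuous.
exact: closed_eq.
Qed.

Lemma quadform_continuous (M : 'M[R]_n) :
  continuous (fun y : 'rV[R]_n => quadform M y^T).
Proof.
have -> : (fun y : 'rV[R]_n => quadform M y^T) =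
          (fun y => \sum_j (\sum_i y 0 i * M i j) * y 0 j).
  apply/funext => y; rewrite quadformE; apply: eq_bigr => j _.
  by rewrite mxE; congr (_ * _); apply: eq_bigr => i _; rewrite mxE.
apply: continuous_sum_rV => j.
apply: continuous_mul_rV; last exact: coord_continuous.
apply: continuous_sum_rV => i; apply: continuous_mul_rV.
  exact: coord_continuous.
exact: cst_continuous.
Qed.

Lemma unit_perp_ones_neq0 : [set y : 'rV[R]_n | S y^T] !=set0.
Proof.
have n_gt0 : (0 < n)%N by exact: ltnW.
pose a := Ordinal n_gt0; pose b := Ordinal n_ge2.
have ba : b != a by [].
have c2 : Num.sqrt (2^-1 : R) * Num.sqrt 2^-1 = 2^-1.
  by rewrite -expr2 sqr_sqrtr // invr_ge0.
pose c := Num.sqrt (2^-1 : R).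
exists (\row_i (if i == a then c else if i == b then - c else 0)).
rewrite unit_perp_onesE; split => /=.
  rewrite (bigD1 a) //= (bigD1 b) //= big1 ?addr0.
    by rewrite !mxE eqxx (negbTE ba) eqxx subrr.
  by move=> i /andP[ia ib]; rewrite mxE (negbTE ia) (negbTE ib).
rewrite (bigD1 a) //= (bigD1 b) //= big1 ?addr0.
  rewrite !mxE eqxx (negbTE ba) eqxx mulrNN /c c2.
  by rewrite -[2^-1]div1r -splitr.
by move=> i /andP[ia ib]; rewrite mxE (negbTE ia) (negbTE ib) mul0r.
Qed.

Lemma alphaP (G : digraph 'I_n) :
  exists2 x, S x & alpha R G = quadform (laplacian R G) x /\
    forall y, S y -> quadform (laplacian R G) x <= quadform (laplacian R G) y.
Proof.
have [z Sz zmin] := EVT_min_rV unit_perp_ones_neq0 unit_perp_ones_compact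
  (continuous_subspaceT (@quadform_continuous (laplacian R G))).
have {}zmin y : S y -> quadform (laplacian R G) z^T <= quadform (laplacian R G) y.
  by move=> Sy; rewrite -[y]trmxK; apply: zmin; rewrite inE /= trmxK.
move: Sz; rewrite inE /= => Sz.
exists z^T => //; split => //; apply/eqP; rewrite eq_le; apply/andP; split.
  apply: ge_inf; last by exists z^T.
  by exists (quadform (laplacian R G) z^T) => _ [y Sy <-]; exact: zmin.
by apply: lb_le_inf; [exists (quadform (laplacian R G) z^T), z^T | move=> _ [y Sy <-]; exact: zmin].
Qed.

Lemma betaP (G : digraph 'I_n) :
  exists2 x, S x & beta R G = quadform (laplacian R G) x /\
    forall y, S y -> quadform (laplacian R G) y <= quadform (laplacian R G) x.
Proof.
have [z Sz zmax] := EVT_max_rV unit_perp_ones_neq0 unit_perp_ones_compact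
  (continuous_subspaceT (@quadform_continuous (laplacian R G))).
have {}zmax y : S y -> quadform (laplacian R G) y <= quadform (laplacian R G) z^T.
  by move=> Sy; rewrite -[y]trmxK; apply: zmax; rewrite inE /= trmxK.
move: Sz; rewrite inE /= => Sz.
exists z^T => //; split => //; apply/eqP; rewrite eq_le; apply/andP; split.
  by apply: ge_sup; [exists (quadform (laplacian R G) z^T), z^T | move=> _ [y Sy <-]; exact: zmax].
apply: ub_le_sup; last by exists z^T.
by exists (quadform (laplacian R G) z^T) => _ [y Sy <-]; exact: zmax.
Qed.

End Attained.

(* Main.v *)
(** The spread vanishes iff the quadratic form of the Laplacian is a multiple
    of the squared norm on the complement of the all-ones vector.  Testing on
    the vectors [e_i - e_j] shows that this amounts to
    [d+(i) + d+(j) + a_ij + a_ji] being the same number for all [i != j].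
    Summing over [j] makes [(n - 1) d+(i) + d-(i)] independent of [i]; as
    [d-(i) <= n - 1], two different out-degrees force every in-degree to be
    [0] or [n - 1], which means an imploding star.  If all out-degrees agree,
    then [a_ij + a_ji] is a constant in [{0, 1, 2}]: the digraph is empty, a
    regular tournament, or complete. *)

Require Import Defs.
From mathcomp Require Import all_boot all_order all_algebra.
From mathcomp Require Import all_classical all_reals all_analysis.
From mathcomp Require Import zify ring lra.

Set Implicit Arguments.
Unset Strict Implicit.
Unset Printing Implicit Defensive.

Import Order.TTheory GRing.Theory Num.Theory.

(** The value of the Laplacian form at [e_i - e_j], a vector of squared norm 2. *)
Definition pair_sum (V : finType) (G : digraph V) (i j : V) : nat :=
  outdeg G i + outdeg G j + edge G i j + edge G j i.

Definition constant_pair_sum (V : finType) (G : digraph V) (T : nat) : Prop :=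
  forall i j, i != j -> pair_sum G i j = T.

(** An imploding star without reference to an isomorphism: [B] is the complete part and its
    complement the empty part. *)
Definition edge_iff_head_in (V : finType) (G : digraph V) (B : {set V}) : Prop :=
  forall i j, edge G i j = (j \in B) && (i != j).

(** * Degree counting under a constant pair sum *)

Section Combinatorics.
Variables (V : finType) (G : digraph V).

Lemma outdeg_sum i : outdeg G i = \sum_j edge G i j.
Proof. by rewrite /outdeg -sum1_card big_mkcond. Qed.

Lemma indeg_sum i : indeg G i = \sum_j edge G j i.
Proof. by rewrite /indeg -sum1_card big_mkcond. Qed.

Lemma sum_indeg : \sum_i indeg G i = \sum_i outdeg G i.
Proof.
under eq_bigr do rewrite indeg_sum; rewrite exchange_big.
by apply: eq_bigr => i _; rewrite outdeg_sum.
Qed.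

Lemma card_neq (i : V) : #|[pred j | j != i]| = #|V|.-1.
Proof. by rewrite -(cardC1 i); apply: eq_card => j; rewrite !inE. Qed.

Lemma indeg_le i : indeg G i <= #|V|.-1.
Proof.
rewrite -(card_neq i); apply/subset_leq_card/fintype.subsetP => j; rewrite !inE.
by apply: contraTneq => ->; rewrite edge_irrefl.
Qed.

Lemma pair_sum_total i :
  \sum_(j | j != i) pair_sum G i j =
  \sum_j outdeg G j + #|V|.-1 * outdeg G i + indeg G i.
Proof.
rewrite /pair_sum !big_split /= sum_nat_const card_neq.
rewrite [\sum_j outdeg G j](bigD1 i) //= outdeg_sum indeg_sum.
rewrite [in \sum_j edge G i j](bigD1 i) //= edge_irrefl.
rewrite [in \sum_j edge G j i](bigD1 i) //= edge_irrefl.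
lia.
Qed.

(** Both sides equal [(#|V| - 1) * T] minus the number of edges. *)
Lemma constant_pair_sum_indeg T i j : constant_pair_sum G T ->
  #|V|.-1 * outdeg G i + indeg G i = #|V|.-1 * outdeg G j + indeg G j.
Proof.
move=> GT; have total k : \sum_j outdeg G j + #|V|.-1 * outdeg G k + indeg G k =
    #|V|.-1 * T.
  rewrite -pair_sum_total -(card_neq k) -sum_nat_const.
  by apply: eq_bigr => l lk; rewrite GT // eq_sym.
have := total i; have := total j; lia.
Qed.

Lemma extremal_indeg_head_in :
  (forall i, indeg G i = 0 \/ indeg G i = #|V|.-1) ->
  edge_iff_head_in G [set j | indeg G j == #|V|.-1].
Proof.
move=> ext i j; rewrite inE.
have [-> | ij] := eqVneq i j; first by rewrite edge_irrefl andbF.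
have [dj | dj] := eqVneq (indeg G j) #|V|.-1; last first.
  case: (ext j) => [/card0_eq/(_ i) | dj']; first by rewrite !inE.
  by rewrite dj' eqxx in dj.
(* The in-neighbours of [j] lie among the other vertices and are equally many, so they are all of
   them. *)
have sub : [pred k | edge G k j] \subset [pred k | k != j].
  apply/fintype.subsetP => k; rewrite !inE.
  by apply: contraTneq => ->; rewrite edge_irrefl.
move: dj; rewrite /indeg -(card_neq j) => /subset_cardP/(_ sub)/(_ i).
by rewrite !inE ij.
Qed.

(** A vertex of [B] has one out-neighbour fewer, as it cannot point to itself; the edge reaching it
    from the other vertex of the pair makes up for this. *)
Lemma head_in_constant_pair_sum B :
  edge_iff_head_in G B -> constant_pair_sum G (2 * #|B|).
Proof.
move=> GB i j ij.
have dE k : outdeg G k + (k \in B) = #|B|.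
  rewrite (cardsD1 k) addnC; congr (_ + _); apply: eq_card => l.
  by rewrite !inE GB andbC eq_sym.
have := dE i; have := dE j.
by rewrite /pair_sum !GB ij eq_sym ij !andbT; lia.
Qed.

Lemma regular_tournament_constant_pair_sum :
  regular_tournament G -> constant_pair_sum G (2 * (#|V|.-1)./2 + 1).
Proof.
move=> [_ _ tG dG] i j ij; rewrite /pair_sum !(dG _).2.
by have := tG i j ij; case: edge; case: edge => //=; lia.
Qed.

Lemma constant_outdeg_cases T d : 1 < #|V| -> constant_pair_sum G T ->
    (forall i, outdeg G i = d) ->
  (exists B, edge_iff_head_in G B) \/ regular_tournament G.
Proof.
move=> V2 GT dG.
have GT' i j : i != j -> d + d + edge G i j + edge G j i = T.
  by move=> ij; rewrite -(GT _ _ ij) /pair_sum !dG.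
have [Tlo | Thi | T1] := ltngtP T (2 * d + 1).
- left; exists finset.set0 => i j; rewrite inE /=.
  have [-> | ij] := eqVneq i j; first exact: edge_irrefl.
  by have := GT' _ _ ij; case: edge => //; lia.
- left; exists finset.setT => i j; rewrite inE /=.
  have [-> | ij] := eqVneq i j; first exact: edge_irrefl.
  by have := GT' _ _ ij; case: edge; case: edge => //; lia.
have tG : tournament G.
  by move=> i j /GT'; case: edge; case: edge => //; lia.
have inG i : indeg G i + d = #|V|.-1.
  rewrite -(dG i) indeg_sum outdeg_sum -big_split /=.
  rewrite (bigD1 i) //= edge_irrefl -(card_neq i) -sum1_card.
  by apply: eq_bigr => j ji; have := tG _ _ ji; case: edge; case: edge.
(* Counting all edges by heads and by tails forces [d] to be half of [#|V| - 1]; hence [#|V|] is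
   odd, and at least 3 as it exceeds 1. *)
have inE' : #|V| * (#|V|.-1 - d) = #|V| * d.
  rewrite -!sum_nat_const; transitivity (\sum_i indeg G i).
    by apply: eq_bigr => i _; rewrite -(inG i) addnK.
  by rewrite sum_indeg; apply: eq_bigr.
have {}inE' : #|V|.-1 - d = d.
  by apply/eqP; rewrite -(eqn_pmul2l (ltnW V2)) inE'.
have /card_gt0P[i0 _] := ltnW V2; have := inG i0 => inGi0.
have dV : d + d = #|V|.-1 by lia.
right; split => //; [lia | lia | move=> i; split; last by rewrite dG; lia].
by have := inG i; lia.
Qed.

Lemma constant_pair_sum_cases T : 1 < #|V| -> constant_pair_sum G T ->
  (exists B, edge_iff_head_in G B) \/ regular_tournament G.
Proof.
move=> V2 GT; have /card_gt0P[i0 _] := ltnW V2.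
have [/forallP dG | /forallPn[j0 dij]] :=
    boolP [forall i, outdeg G i == outdeg G i0].
  by apply: (constant_outdeg_cases V2 GT) => i; exact/eqP/dG.
left; exists [set j | indeg G j == #|V|.-1]; apply: extremal_indeg_head_in.
(* The in-degree gap is [#|V| - 1] times the out-degree gap, yet at most [#|V| - 1], so both
   in-degrees are extreme. *)
have jump i j : outdeg G i < outdeg G j ->
    indeg G i = #|V|.-1 /\ indeg G j = 0.
  move=> dlt; have := constant_pair_sum_indeg i j GT.
  by have := indeg_le i; nia.
move=> i; have [/jump[-> _] | /jump[_ ->] | di] :=
  ltngtP (outdeg G i) (outdeg G i0); [by right | by left | ].
(* A vertex with the out-degree of [i0] is compared with [j0] instead. *)
by move: dij; rewrite -di neq_ltn => /orP[] /jump[]; [left | right].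
Qed.

End Combinatorics.

(** * Imploding stars up to isomorphism *)

Lemma iso_imploding_star (n : nat) (G : digraph 'I_n) :
  (exists2 k : nat, k <= n & iso G (imploding_star n k)) <->
  exists B, edge_iff_head_in G B.
Proof.
split=> [[k kn [f fbij fE]] | [B GB]].
  exists [set j | if f j is inr _ then true else false] => i j.
  rewrite inE -fE -(inj_eq (bij_inj fbij)).
  by case: (f i) (f j) => [a | a] [b | b].
have Bn : #|B| <= n by rewrite -[n in _ <= n]card_ord max_card.
have CBn : n - #|B| = #|~: B| by rewrite [RHS]cardsCs finset.setCK card_ord.
pose g (u : 'I_(n - #|B|) + 'I_#|B|) : 'I_n :=
  match u with
  | inl a => enum_val (cast_ord CBn a)
  | inr b => enum_val b
  end.
have gB u : (g u \in B) = if u is inr _ then true else false.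
  case: u => u /=; last exact: enum_valP.
  by have := enum_valP (cast_ord CBn u); rewrite inE => /negbTE.
have ginj : injective g.
  move=> u v guv; have := gB v; rewrite -guv gB.
  case: u v guv => [a | a] [b | b] //= /enum_val_inj; last by move->.
  by move/cast_ord_inj->.
(* An injection between sets of equal size; [Bn] makes the truncated subtraction exact. *)
have [f gK fK] : bijective g.
  by apply: inj_card_bij => //; rewrite card_sum !card_ord subnK.
exists #|B| => //; exists f; first by exists g.
move=> i j; rewrite GB -{2}[j]fK gB -(inj_eq (can_inj fK)).
by case: (f i) (f j) => [a | a] [b | b].
Qed.

Local Open Scope ring_scope.

(** * The Laplacian form on the complement of the all-ones vector *)

Section Spread.
Variables (R : realType) (n : nat).
Implicit Types (G : digraph 'I_n) (x : 'cV[R]_n).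

Lemma quadformZ (M : 'M[R]_n) a x : quadform M (a *: x) = a ^+ 2 * quadform M x.
Proof.
by rewrite /quadform -scalemxAr [(a *: x)^T]linearZ /= -!scalemxAl scalerA mxE expr2.
Qed.

Lemma quadform_delta (M : 'M[R]_n) i j :
  quadform M (delta_mx i 0 - delta_mx j 0) =
  M i i + M j j - M i j - M j i.
Proof.
have dMd k l : ((delta_mx k 0 : 'cV[R]_n)^T *m M *m (delta_mx l 0 : 'cV[R]_n)) 0 0 = M k l.
  by rewrite trmx_delta -rowE -colE !mxE.
rewrite /quadform raddfB /= raddfB /= !mulmxBl.
move: (dMd i i) (dMd i j) (dMd j i) (dMd j j).
by do 4 move=> /[dup] _ <-; rewrite !mxE; ring.
Qed.

Lemma quadformD (M N : 'M[R]_n) x :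
  quadform (M + N) x = quadform M x + quadform N x.
Proof. by rewrite /quadform mulmxDr mulmxDl mxE. Qed.

Lemma quadform_tr (M : 'M[R]_n) x : quadform M^T x = quadform M x.
Proof.
have -> : quadform M x = (x^T *m M *m x)^T 0 0 by rewrite mxE.
by rewrite !trmx_mul trmxK mulmxA.
Qed.

Lemma laplacianE G i j :
  laplacian R G i j = (outdeg G i)%:R *+ (i == j) - (edge G i j)%:R.
Proof. by rewrite !mxE. Qed.

Lemma dot_quadform x : dot x x = quadform 1%:M x.
Proof. by rewrite /quadform mulmx1. Qed.

Lemma unit_perp_ones_delta (i j : 'I_n) : i != j ->
  unit_perp_ones (Num.sqrt 2^-1 *: (delta_mx i 0 - delta_mx j 0) : 'cV[R]_n).
Proof.
move=> ij; split.
  rewrite /dot linearZ raddfB /= -scalemxAl mulmxBl !trmx_delta -!rowE !mxE.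
  by rewrite subrr mulr0.
rewrite /enorm dot_quadform quadformZ quadform_delta !mxE !eqxx (eq_sym j).
by rewrite (negbTE ij) sqr_sqrtr ?invr_ge0 // !subr0 mulVf ?sqrtr1 //.
Qed.

(** Off the diagonal, [-(a_ij + a_ji)] is [d_i + d_j - T], which splits evenly as [u_i + u_j]; the
    diagonal fits since [2 d_i = T + 2 u_i]. The correction to the scalar matrix vanishes as a form
    on vectors orthogonal to the ones vector. *)
Lemma laplacian_sym_decomposition G T : constant_pair_sum G T ->
  let u : 'cV[R]_n := \col_i ((outdeg G i)%:R - T%:R / 2) in
  laplacian R G + (laplacian R G)^T =
  T%:R%:M + (u *m (const_mx 1)^T + const_mx 1 *m u^T).
Proof.
move=> GT u; apply/matrixP => i j.
rewrite mxE [_^T _ _]mxE !laplacianE !(mxE, big_ord1) mulr1 mul1r.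
have [<- | ij] := eqVneq i j; first by rewrite edge_irrefl !mulr1n mulr0n; field.
have := GT i j ij; rewrite /pair_sum => <-; rewrite !natrD.
by rewrite !mulr0n; field.
Qed.

Lemma constant_pair_sum_quadform G T x : constant_pair_sum G T ->
  unit_perp_ones x -> quadform (laplacian R G) x = T%:R / 2.
Proof.
move=> GT [xe xx].
have {}xe : x^T *m const_mx 1 = 0 :> 'M[R]_1.
  by apply/matrixP => i j; rewrite !ord1 [RHS]mxE.
have ex : (const_mx 1)^T *m x = 0 :> 'M[R]_1.
  by rewrite -[x]trmxK -trmx_mul xe trmx0.
have {}xx : dot x x = 1.
  have x0 : 0 <= dot x x.
    by rewrite dotE; apply: sumr_ge0 => i _; rewrite -expr2 sqr_ge0.
  by rewrite -(sqr_sqrtr x0) -/(enorm x) xx expr1n.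
(* A form depends only on the symmetric part of its matrix, so its double is the form of the
   Laplacian plus its transpose. *)
suff : quadform (laplacian R G) x + quadform (laplacian R G) x = T%:R.
  by lra.
rewrite -{2}quadform_tr -quadformD (laplacian_sym_decomposition GT) /quadform.
rewrite !mulmxDr !mulmxDl !mulmxA xe !mul0mx.
rewrite -[in X in X + _]mulmxA -[X in _ + (X + _)]mulmxA ex mulmx0 !addr0.
by rewrite mulmxA mul_mx_scalar -scalemxAl mxE -/(dot x x) xx mulr1.
Qed.

Lemma lspread_eq0P G : (2 <= n)%N ->
  lspread R G = 0 <-> exists T, constant_pair_sum G T.
Proof.
move=> n2; rewrite /lspread.
have [y Sy [-> ymin]] := alphaP R n2 G; have [z Sz [-> zmax]] := betaP R n2 G.
split=> [/eqP | [T GT]]; last first.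
  by rewrite !(constant_pair_sum_quadform GT) // subrr.
rewrite subr_eq0 => /eqP yz.
(* With equal extremes the form is constant on the unit vectors; the half comes from normalizing
   [e_i - e_j]. *)
have cst i j : i != j -> (pair_sum G i j)%:R / 2 = quadform (laplacian R G) y.
  move=> ij; have Sx := unit_perp_ones_delta ij.
  have := zmax _ Sx; have := ymin _ Sx; rewrite yz => lo hi.
  have /eqP : quadform (laplacian R G)
      (Num.sqrt 2^-1 *: (delta_mx i 0 - delta_mx j 0)) =
      quadform (laplacian R G) y by apply/eqP; rewrite eq_le hi lo.
  rewrite quadformZ quadform_delta sqr_sqrtr ?invr_ge0 // => /eqP <-.
  rewrite !laplacianE !eqxx (eq_sym j) (negbTE ij) !edge_irrefl !mulr0n !mulr1n.
  by rewrite /pair_sum !natrD; field.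
pose a := Ordinal (ltnW n2); pose b := Ordinal n2.
exists (pair_sum G a b) => i j ij; apply/eqP; rewrite -(eqr_nat R); apply/eqP.
by have := cst i j ij; rewrite -(cst a b isT); lra.
Qed.

End Spread.

Theorem corollary3p2 (R : realType) (n : nat) (G : digraph 'I_n) (hn : (2 <= n)%N) :
  @lspread R n G = 0%R <->
  (exists2 k : nat, (k <= n)%N & iso G (imploding_star n k)) \/
  regular_tournament G.
Proof.
rewrite (lspread_eq0P R G hn) iso_imploding_star; split=> [[T] | [[B] | ]].
- by apply: constant_pair_sum_cases; rewrite card_ord.
- by move/head_in_constant_pair_sum; exists (2 * #|B|)%N.
- by move/regular_tournament_constant_pair_sum; exists (2 * (#|'I_n|.-1)./2 + 1)%N.
Qed.
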